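(* For every triple of positive integers $r,d,m$, there exists $c=c(r,m)>0$, depending only on $r$ and $m$ (and not on $d$), such that for every positive integer $n$, $$R_{r}^{d,1,m}(n)\leq 2^{cn^{4r^{2}m^{2}}}.$$
   Context: An $r$-uniform hypergraph $H$ is semi-algebraic of complexity $(d,D,m)$ if there is an enumeration $v_1,\dots,v_N$ of its vertices, an assignment $v_i\mapsto p_i\in\mathbb{R}^d$ for $i\in[N]=\{1,\dots,N\}$, $m$ polynomials $f_1,\dots,f_m:(\mathbb{R}^d)^r\to\mathbb{R}$ of (total) degree at most $D$, and a function $\Phi:\{+,-,0\}^m\to\{\text{True},\text{False}\}$ such that for all $1\le i_1<\dots<i_r\le N$, the set $\{v_{i_1},\dots,v_{i_r}\}$ is an edge of $H$ if and only if $\Phi(\operatorname{sign}f_1(p_{i_1},\dots,p_{i_r}),\dots,\operatorname{sign}f_m(p_{i_1},\dots,p_{i_r}))=\text{True}$, where $\operatorname{sign}(x)\in\{+,-,0\}$ is the sign of $x$. The Ramsey number $R_r^{d,D,m}(n)$ is the smallest $N$ such that every $r$-uniform semi-algebraic hypergraph of complexity $(d,D,m)$ on $N$ vertices contains either a clique of size $n$ (a set of $n$ vertices all of whose $r$-element subsets are edges) or an independent set of size $n$ (a set of $n$ vertices none of whose $r$-element subsets is an edge). *)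

(* Defs.v *)
From HB Require Import structures.
From mathcomp Require Import all_boot all_order all_algebra.
From mathcomp Require Import reals exp.
(* The notations of mpoly clash with those of mathcomp-analysis. *)
From mathcomp Require Import -(notations) mpoly.

Set Implicit Arguments.
Unset Strict Implicit.
Unset Printing Implicit Defensive.

Import Order.TTheory GRing.Theory Num.Theory.
Local Open Scope ring_scope.

Inductive sign := Pos | Neg | Zero.

Definition sign_of (R : realDomainType) (x : R) : sign :=
  if x == 0 then Zero else if 0 < x then Pos else Neg.

(* Hypergraphs on a vertex set V are given by their set of edges. *)
Definition uniform (r : nat) (V : finType) (E : {set {set V}}) : Prop :=
  forall e : {set V}, e \in E -> #|e| = r.

(* A polynomial function on (R^d)^r is a polynomial in r * d variables; the
   r points are the rows of an r x d matrix, flattened by mxvec. *)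
Definition eval_points (R : comNzRingType) (r d : nat) (f : mpoly (r * d) R)
    (q : 'I_r -> 'rV[R]_d) : R :=
  meval (fun k : 'I_(r * d) => mxvec (\matrix_(a < r) q a) 0 k) f.

(* msize f is 1 + the total degree of f (and 0 if f = 0), so msize f <= D.+1
   means that f has total degree at most D. *)
Definition semi_algebraic (R : realType) (r d D m : nat) (V : finType)
    (E : {set {set V}}) : Prop :=
  exists (v : 'I_#|V| -> V) (p : 'I_#|V| -> 'rV[R]_d)
         (f : 'I_m -> mpoly (r * d) R) (Phi : {ffun 'I_m -> sign} -> bool),
    [/\ bijective v,
        forall k : 'I_m, (msize (f k) <= D.+1)%N
      & forall i : 'I_r -> 'I_#|V|,
          (forall a b : 'I_r, (a < b)%N -> (i a < i b)%N) ->
          ([set v (i a) | a : 'I_r] \in E)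
          = Phi [ffun k => sign_of (eval_points (f k) (fun a => p (i a)))]].

Definition clique (r : nat) (V : finType) (E : {set {set V}}) (S : {set V}) :
    Prop :=
  forall e : {set V}, e \subset S -> #|e| = r -> e \in E.

Definition independent (r : nat) (V : finType) (E : {set {set V}})
    (S : {set V}) : Prop :=
  forall e : {set V}, e \subset S -> #|e| = r -> e \notin E.

Definition ramsey_property (R : realType) (r d D m n N : nat) : Prop :=
  forall (V : finType) (E : {set {set V}}),
    #|V| = N -> uniform r E -> semi_algebraic R r d D m E ->
    exists S : {set V}, #|S| = n /\ (clique r E S \/ independent r E S).

Definition is_ramsey_number (R : realType) (r d D m n N : nat) : Prop :=
  ramsey_property R r d D m n N /\
  forall N' : nat, ramsey_property R r d D m n N' -> (N <= N')%N.

(* Main.v *)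
(* A linear form in r points is a sum of functions of the single points, so the
   dimension d disappears: the edges depend on the signs of m sums
   x_1(i_1) + ... + x_r(i_r) of functions of the indices, r m functions in all.
   An Erdos-Rado argument yields a subsequence of length T from 2^O(T^2)
   vertices along which every function is monotone and a comparison of two gaps
   |x(j) - x(i)| and |x(l) - x(j)|, i < j < l, does not depend on l. With the
   last point as l, this comparison becomes a threshold relation on pairs, and
   so do the comparisons between two functions. A family of q such relations is
   made homogeneous on n points out of n^(q+1), where q = m r^2 here; this is
   where 2 (m r^2 + 1) <= 4 r^2 m^2 enters. On the resulting set each function
   is, up to an additive constant, geometrically increasing or decreasing, and
   after thinning out one and the same term dominates each sum. *)
Require Import Defs.
From mathcomp Require Import all_boot all_order all_algebra.
From mathcomp Require Import reals exp.
From mathcomp Require Import boolp zify lra.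
From mathcomp Require Import -(notations) mpoly.

Set Implicit Arguments.
Unset Strict Implicit.
Unset Printing Implicit Defensive.

Import Order.TTheory GRing.Theory Num.Theory.
Local Open Scope ring_scope.


(** * Pigeonhole selection of subsequences *)

Definition increasing_on (n : nat) (g : nat -> nat) :=
  forall p q : nat, (p < q)%N -> (q < n)%N -> (g p < g q)%N.

Lemma pigeonhole (T : eqType) (C : finType) (c : T -> C) (s : seq T) :
  exists d : seq T, [/\ subseq d s, (size s <= #|C| * size d)%N
    & {in d &, forall x y, c x = c y}].
Proof.
case: s => [|x0 s]; first by exists [::]; split=> //; rewrite muln0.
set t := x0 :: s.
pose cnt (k : C) := count (fun x => c x == k) t.
pose k0 := [arg max_(k > c x0) cnt k].
exists [seq x <- t | c x == k0]; split; first exact: filter_subseq.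
  have -> : size t = (\sum_(k : C) cnt k)%N.
    rewrite /cnt; under eq_bigr do rewrite -sum1_count big_mkcond.
    rewrite exchange_big -(sum1_size t); apply: eq_bigr => x _.
    by rewrite -big_mkcond /= (big_pred1 (c x)).
  rewrite size_filter -sum_nat_const; apply: leq_sum => k _.
  by rewrite /k0; case: arg_maxnP => // i _; apply.
by move=> x y; rewrite !mem_filter => /andP[/eqP -> _] /andP[/eqP -> _].
Qed.

Lemma sorted_nth_increasing (d : seq nat) :
  sorted ltn d -> increasing_on (size d) (nth 0%N d).
Proof.
move=> sd p q pq qn; apply: (sorted_ltn_nth ltn_trans) => //.
by rewrite inE (ltn_trans pq).
Qed.

Lemma pigeonhole_subsequence (C : finType) (c : nat -> C) (M n : nat) :
  (#|C| * n <= M)%N ->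
  exists g : nat -> nat, [/\ increasing_on n g,
    forall p, (p < n)%N -> (g p < M)%N
    & forall p q, (p < n)%N -> (q < n)%N -> c (g p) = c (g q)].
Proof.
move=> leM; have [d [ds szd cd]] := pigeonhole c (iota 0 M).
have C0 : (0 < #|C|)%N by apply/card_gt0P; exists (c 0%N).
have nd : (n <= size d)%N.
  by rewrite -(leq_pmul2l C0); apply: leq_trans leM _; rewrite -{1}(size_iota 0 M).
have sd : sorted ltn d.
  by apply: subseq_sorted ds (iota_ltn_sorted _ _); exact: ltn_trans.
exists (nth 0%N d); split.
- by move=> p q pq qn; apply: sorted_nth_increasing => //; apply: leq_trans nd.
- move=> p pn; have := mem_subseq ds (mem_nth 0%N (leq_trans pn nd)).
  by rewrite mem_iota.
- by move=> p q pn qn; apply: cd; apply: mem_nth; apply: leq_trans nd.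
Qed.

(** * Erdos-Rado selection: triple colours that ignore the largest index *)

Section Prehomogeneous.
Variables (C : finType) (c : nat -> nat -> nat -> C).

Lemma pigeonhole_list (fs : seq (nat -> C)) (s : seq nat) :
  exists d : seq nat, [/\ subseq d s, (size s <= #|C| ^ size fs * size d)%N
    & forall i, (i < size fs)%N ->
        {in d &, forall x y, nth (c 0 0)%N fs i x = nth (c 0 0)%N fs i y}].
Proof.
elim: fs s => [|f fs IH] s; first by exists s; split=> //; rewrite mul1n.
have [d [ds szd hd]] := IH s; have [d' [ds' szd' hd']] := pigeonhole f d.
exists d'; split; first exact: subseq_trans ds' ds.
  apply: leq_trans szd _; rewrite /= expnSr -mulnA.
  by rewrite leq_mul2l szd' orbT.
case=> [|i] /= ltis x y xd yd; first exact: hd'.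
by apply: hd => //; apply: (mem_subseq ds').
Qed.

(** [pre] lists the points selected before [d]. Taking [x] from [rcons pre y] admits [x = y], so
    that conditions on pairs can be read off the same triple colour. *)
Fixpoint prehomogeneous (pre d : seq nat) : Prop :=
  if d is y :: d' then
    (forall x z z', x \in rcons pre y -> z \in d' -> z' \in d' ->
       c x y z = c x y z') /\ prehomogeneous (rcons pre y) d'
  else True.

(** Selecting [y] splits the rest by the colours against at most [T] points, [y] included, so a
    fraction of at least [1 / #|C| ^ T] survives. The factor 2 pays for the removal of [y]. *)
Lemma prehomogeneous_subseq (T u : nat) (pre s : seq nat) :
  (size pre + u <= T)%N -> ((2 * #|C| ^ T) ^ u <= size s)%N ->
  exists d : seq nat, [/\ subseq d s, size d = u & prehomogeneous pre d].
Proof.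
elim: u pre s => [|u IH] pre s szpre szs.
  by exists [::]; split=> //; apply: sub0seq.
have C0 : (0 < #|C|)%N by apply/card_gt0P; exists (c 0 0 0)%N.
have CT0 : (0 < #|C| ^ T)%N by rewrite expn_gt0 C0.
have K0 : (0 < (2 * #|C| ^ T) ^ u)%N by rewrite expn_gt0 muln_gt0 CT0.
case: s szs => [|y s] szs.
  by move: szs; rewrite leqNgt expnS !muln_gt0 CT0 K0.
have [e [es sze he]] := pigeonhole_list [seq c x y | x <- rcons pre y] s.
have [|//|d [de szd hd]] := IH (rcons pre y) e.
  by rewrite size_rcons; lia.
  rewrite -(leq_pmul2l CT0).
  apply: (@leq_trans (size s)).
    move: szs; rewrite expnS /= -mulnA mul2n -addnn => szs.
    rewrite -ltnS; apply: leq_trans szs.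
    by rewrite -[X in (X < _)%N]addn0 ltn_add2l muln_gt0 CT0.
  apply: leq_trans sze _; rewrite leq_mul2r leq_pexp2l ?orbT //.
  by rewrite size_map size_rcons; lia.
exists (y :: d); split=> /=.
- by rewrite eqxx; apply: subseq_trans de es.
- by rewrite szd.
split=> // x z z' xpre zd zd'.
have idx : (index x (rcons pre y) < size (rcons pre y))%N by rewrite index_mem.
have := he (index x (rcons pre y)); rewrite size_map => /(_ idx z z').
rewrite (nth_map 0%N) // nth_index //; apply; exact: (mem_subseq de).
Qed.

Lemma prehomogeneous_nth (pre d : seq nat) (i j l l' : nat) :
  prehomogeneous pre d -> (i <= j)%N -> (j < l)%N -> (j < l')%N ->
  (l < size d)%N -> (l' < size d)%N ->
  c (nth 0 d i)%N (nth 0 d j)%N (nth 0 d l)%N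
  = c (nth 0 d i)%N (nth 0 d j)%N (nth 0 d l')%N.
Proof.
(* The entry at [i] is replaced by any [x] that occurs early enough in [pre ++ d], because the
   induction moves the heads of [d] into [pre]. *)
suff H x : x \in pre ++ d -> (index x (pre ++ d) <= size pre + j)%N ->
  prehomogeneous pre d -> (j < l)%N -> (j < l')%N ->
  (l < size d)%N -> (l' < size d)%N ->
  c x (nth 0 d j)%N (nth 0 d l)%N = c x (nth 0 d j)%N (nth 0 d l')%N.
  move=> hd ij jl jl' ld ld'; apply: H => //.
    rewrite mem_cat; apply/orP; right; apply: mem_nth.
    by apply: leq_ltn_trans ij (ltn_trans jl ld).
  have -> : nth 0%N d i = nth 0%N (pre ++ d) (size pre + i).
    by rewrite nth_cat ltnNge leq_addr /= addKn.
  apply: (@leq_trans (size pre + i)); last by rewrite leq_add2l.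
  have idx : (size pre + i < size (pre ++ d))%N by rewrite size_cat; lia.
  rewrite leqNgt; apply/negP => /(before_find 0%N) /=.
  by rewrite eqxx.
elim: d pre j l l' => [//|y d IH] pre j l l' xin xj /= [hy hd].
case: l l' => [//|l] [//|l'] jl jl' ld ld'; case: j jl jl' xj => [|j] jl jl' xj /=.
  apply: hy; rewrite ?mem_nth //.
  move: xin xj; rewrite -cat_rcons => xin xj.
  move: (xin); rewrite mem_cat => /orP[//|xd].
  case: (boolP (x \in rcons pre y)) => // xn; move: xj.
  by rewrite index_cat (negbTE xn) size_rcons addn0 addSn ltnNge leq_addr.
apply: (IH (rcons pre y)) => //; rewrite ?cat_rcons //.
by rewrite size_rcons addSnnS.
Qed.

Lemma erdos_rado (T N : nat) : ((2 * #|C| ^ T) ^ T <= N)%N ->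
  exists g : nat -> nat, [/\ increasing_on T g,
    forall p, (p < T)%N -> (g p < N)%N
    & forall i j l l', (i <= j)%N -> (j < l)%N -> (j < l')%N -> (l < T)%N ->
        (l' < T)%N -> c (g i) (g j) (g l) = c (g i) (g j) (g l')].
Proof.
move=> leN.
have [||d [ds szd hd]] := @prehomogeneous_subseq T T [::] (iota 0 N).
- by [].
- by rewrite size_iota.
exists (nth 0%N d); split.
- rewrite -szd; apply: sorted_nth_increasing.
  by apply: subseq_sorted ds (iota_ltn_sorted _ _); exact: ltn_trans.
- move=> p pT; have := mem_subseq ds (mem_nth 0%N (_ : p < size d)%N).
  by rewrite mem_iota szd; apply.
- by move=> i j l l' *; apply: (prehomogeneous_nth (pre := [::])); rewrite ?szd.
Qed.
End Prehomogeneous.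

(** * Simultaneous homogeneity for hereditary relations *)

Definition hereditary_below (B : nat) (G : rel nat) :=
  forall i i' j' j : nat, (i <= i')%N -> (i' < j')%N -> (j' <= j)%N ->
    (j < B)%N -> G i j -> G i' j'.

(* Cut [o, o + M) into n blocks of length n ^ size s. If some relation holds
   between the ends of a block, it holds on the whole block, where one recurses
   with one relation less; otherwise the left ends of the blocks are good. *)
Lemma homogeneous_hereditary (I : eqType) (G : I -> rel nat) (B n : nat)
    (s : seq I) (o M : nat) :
  (forall x, x \in s -> hereditary_below B (G x)) ->
  (n ^ (size s).+1 <= M)%N -> (o + M <= B)%N ->
  exists g : nat -> nat, [/\ increasing_on n g,
    forall p, (p < n)%N -> (o <= g p < o + M)%N
    & forall x, x \in s -> exists b : bool, forall p q, (p < q)%N ->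
        (q < n)%N -> G x (g p) (g q) = b].
Proof.
have [k] := ubnP (size s); elim: k s o M => // k IH s o M szk hs leM leB.
case: n IH leM => [|n] IH leM.
  by exists id; split=> // x _; exists true.
pose L := (n.+1 ^ size s)%N.
have L0 : (0 < L)%N by rewrite expn_gt0.
have LM : (L * n.+1 <= M)%N by rewrite -expnSr.
have tLM t : (t < n.+1)%N -> (t * L + L <= M)%N.
  by move=> tn; apply: leq_trans LM; rewrite addnC -mulSn mulnC leq_mul2l tn orbT.
(* Only [n] of the [n.+1] blocks are tested: the right end of the last one may be [B], about which
   [hereditary_below] says nothing. Two distinct left ends always enclose a tested block. *)
case: (boolP (has (fun x => [exists t : 'I_n,
    G x (o + t * L)%N (o + t.+1 * L)%N]) s)).
  move=> /hasP[x xs /existsP[t Gt]].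
  have szr : size s = (size (rem x s)).+1.
    by rewrite size_rem // prednK //; case: (s) xs.
  have tn := ltn_ord t.
  have h1 := tLM t (ltnW tn).
  have h2 := tLM t.+1 tn.
  have [||||g [g1 g2 g3]] := IH (rem x s) (o + t * L)%N L.
  - by move: szk; rewrite szr.
  - by move=> y /mem_rem; apply: hs.
  - by rewrite /L szr.
  - lia.
  exists g; split=> //.
    by move=> p /g2; lia.
  move=> y ys; case: (eqVneq y x) => [->|yx].
    exists true => p q pq qn; apply: (hs x xs _ _ _ _ _ _ _ _ Gt).
    - by have := g2 p (ltn_trans pq qn); lia.
    - exact: g1.
    - by have := g2 q qn; rewrite mulSn; lia.
    - by move: h2; rewrite mulSn; lia.
  apply: g3; move: ys.
  by rewrite (perm_mem (perm_to_rem xs)) inE (negbTE yx).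
move=> /hasPn nG; exists (fun t => o + t * L)%N; split.
- by move=> p q pq qn; rewrite ltn_add2l ltn_pmul2r.
- by move=> p /tLM; lia.
move=> x xs; exists false => p q pq qn; apply: contraNF (nG x xs) => Gpq.
have pn : (p < n)%N by lia.
apply/existsP; exists (Ordinal pn) => /=.
have := tLM q qn => hq.
apply: (hs x xs _ _ _ _ _ _ _ _ Gpq) => //; last lia.
- by rewrite mulSn; lia.
- by rewrite leq_add2l leq_mul2r pq orbT.
Qed.


(** * Signs of sums with a dominant term *)

Lemma sign_ofP (R : realDomainType) (x y : R) :
  sign_of x = sign_of y <-> ((x == 0) = (y == 0) /\ (0 < x) = (0 < y)).
Proof.
by rewrite /sign_of; case: (ltrgt0P x) => hx; case: (ltrgt0P y) => hy;
   split=> // -[].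
Qed.

(** The other terms together are at most [(#|O| - 1) / #|O|] times [|v o|], hence strictly smaller
    unless everything vanishes. *)
Lemma sign_sum_dominated (R : realFieldType) (O : finType) (v : O -> R)
    (o : O) :
  (forall o', o' != o -> #|O|%:R * `|v o'| <= `|v o|) ->
  sign_of (\sum_o' v o') = sign_of (v o).
Proof.
move=> dom; rewrite (bigD1 o) //=.
set S := \sum_(_ | _) _.
have O0 : (0 < #|O|)%N by apply/card_gt0P; exists o.
have : #|O|%:R * `|S| <= (#|O|%:R - 1) * `|v o|.
  apply: (@le_trans _ _ (\sum_(o' | o' != o) #|O|%:R * `|v o'|)).
    by rewrite -mulr_sumr ler_wpM2l ?ler0n // ler_norm_sum.
  apply: (@le_trans _ _ (\sum_(o' | o' != o) `|v o|)); first exact: ler_sum.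
  rewrite sumr_const -[X in _ *+ X]/(#|predC1 o|) cardC1.
  by rewrite -{2}(prednK O0) -natr1 addrK mulr_natl.
have : 1 <= #|O|%:R :> R by rewrite ler1n.
move: (#|O|%:R : R) => N N1 bnd.
have {bnd} lt : v o = 0 /\ S = 0 \/ `|S| < `|v o|.
  have [v0|v0] := eqVneq (v o) 0.
    left; split=> //; apply/eqP; rewrite -normr_le0.
    by move: bnd; rewrite v0 normr0 mulr0 pmulr_rle0 //; lra.
  right; rewrite -normr_gt0 in v0.
  rewrite ltNge; apply/negP => le.
  have := ler_wpM2l (_ : 0 <= N) le; nra.
case: lt => [[-> ->]|]; first by rewrite addr0.
move=> lt; apply/sign_ofP.
by case: (ltrgt0P (v o)) lt => hv; case: (ltrgt0P S) => hS lt;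
  rewrite ?hv ?hS ?normr0 in lt *; split; lra.
Qed.

(** A largest term of [v] beats every other one by the factor [#|O|]. Each comparison points the
    same way for [v'], so the same term dominates there and fixes the sign. *)
Lemma sign_sum_uniform (R : realFieldType) (O : finType) (v v' : O -> R) :
  (forall o, sign_of (v o) = sign_of (v' o)) ->
  (forall o o', o != o' ->
     (#|O|%:R * `|v o'| <= `|v o| /\ #|O|%:R * `|v' o'| <= `|v' o|) \/
     (#|O|%:R * `|v o| <= `|v o'| /\ #|O|%:R * `|v' o| <= `|v' o'|)) ->
  sign_of (\sum_o v o) = sign_of (\sum_o v' o).
Proof.
move=> sgn cmp.
have [/forallP v0|] := boolP [forall o, v o == 0].
  rewrite !big1 // => o _; apply/eqP; last exact: v0.
  by have /sign_ofP[<- _] := sgn o; apply: v0.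
rewrite negb_forall => /existsP[o0 vo0].
pose o := [arg max_(i > o0) `|v i|]%O.
have omax i : `|v i| <= `|v o|.
  by rewrite /o; case: arg_maxP => // j _; apply.
have vo : 0 < `|v o| by apply: lt_le_trans (omax o0); rewrite normr_gt0.
have dom o' : o' != o ->
    #|O|%:R * `|v o'| <= `|v o| /\ #|O|%:R * `|v' o'| <= `|v' o|.
  move=> o'o; have [[le _]|//] := cmp _ _ o'o; exfalso.
  have O2 : 2 <= #|O|%:R :> R.
    by rewrite (ler_nat _ 2); have := max_card (pred2 o' o); rewrite card2 o'o.
  have := omax o'; nra.
rewrite !(@sign_sum_dominated _ _ _ o) // => o' /dom[] //.
Qed.

(** * Geometric sequences and thinning *)

Definition geometric (R : numDomainType) (M : nat) (e : nat -> R) :=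
  (forall p q, (p < q)%N -> (q < M)%N -> 2 * e q <= e p) \/
  (forall p q, (p < q)%N -> (q < M)%N -> 2 * e p <= e q).

Lemma geometric_iter (R : realFieldType) (M p s : nat) (e : nat -> R) :
  (p + s < M)%N ->
  ((forall p q, (p < q)%N -> (q < M)%N -> 2 * e q <= e p) ->
     2 ^+ s * e (p + s)%N <= e p) /\
  ((forall p q, (p < q)%N -> (q < M)%N -> 2 * e p <= e q) ->
     2 ^+ s * e p <= e (p + s)%N).
Proof.
move=> psM; split=> h; elim: s psM => [|s IH] psM.
- by rewrite addn0 mul1r.
- apply: le_trans (IH _); last lia.
  rewrite exprSr -mulrA ler_wpM2l ?exprn_ge0 //; apply: h; lia.
- by rewrite addn0 mul1r.
- rewrite exprS -mulrA; apply: le_trans (h (p + s)%N _ _ _); try lia.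
  by rewrite ler_wpM2l // IH //; lia.
Qed.

(** Whether [p - s] or [p + s] serves as [q] depends on the direction of [e]; later only the
    distance from [p] matters. *)
Lemma geometric_near (R : realFieldType) (M p s : nat) (e : nat -> R) :
  geometric M e -> (s <= p)%N -> (p + s < M)%N ->
  (exists q, [/\ (p <= q + s)%N, (q <= p + s)%N & 2 ^+ s * e q <= e p]) /\
  (exists q, [/\ (p <= q + s)%N, (q <= p + s)%N & 2 ^+ s * e p <= e q]).
Proof.
move=> ge sp psM.
have pM : (p - s + s < M)%N by lia.
have pE : (p - s + s)%N = p by lia.
have [d1 i1] := geometric_iter e psM.
have [d2 i2] := geometric_iter e pM; rewrite pE in d2 i2.
case: ge => h; split.
- by exists (p + s)%N; split; [lia|lia|exact: d1].
- by exists (p - s)%N; split; [lia|lia|exact: d2].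
- by exists (p - s)%N; split; [lia|lia|exact: i2].
- by exists (p + s)%N; split; [lia|lia|exact: i1].
Qed.

(** The points [s + (2 * s).+1 * t] are centres of disjoint windows of radius [s]. Moving inside a
    window gains the factor [2 ^ s > r] without changing the order of the points, so a plain
    comparison becomes domination by the number [r + 1] of terms. *)
Lemma sparse_sign (R : realFieldType) (r n s M : nat) (c : R)
    (u : 'I_r -> nat -> R) :
  (forall a, geometric M (fun p => `|u a p|)) ->
  (forall a p q, (p < M)%N -> (q < M)%N -> sign_of (u a p) = sign_of (u a q)) ->
  (forall a b : 'I_r, (a < b)%N ->
     (forall p q, (p < q)%N -> (q < M)%N -> `|u b q| <= `|u a p|) \/
     (forall p q, (p < q)%N -> (q < M)%N -> `|u a p| <= `|u b q|)) ->
  (forall a, (forall p, (p < M)%N -> `|c| <= `|u a p|) \/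
             (forall p, (p < M)%N -> `|u a p| <= `|c|)) ->
  (r < 2 ^ s)%N -> ((2 * s).+1 * n <= M)%N ->
  forall t t' : 'I_r -> nat,
    (forall a b : 'I_r, (a < b)%N -> (t a < t b)%N) ->
    (forall a b : 'I_r, (a < b)%N -> (t' a < t' b)%N) ->
    (forall a, t a < n)%N -> (forall a, t' a < n)%N ->
    sign_of (c + \sum_a u a (s + (2 * s).+1 * t a)%N)
    = sign_of (c + \sum_a u a (s + (2 * s).+1 * t' a)%N).
Proof.
move=> geo sgn cmp cmpc rs nM t t' ti ti' tn tn'.
(* The constant [c] is treated as one more term, with index [None]. *)
pose v (t : 'I_r -> nat) (o : option 'I_r) :=
  if o is Some a then u a (s + (2 * s).+1 * t a)%N else c.
have sumv t0 : c + \sum_a u a (s + (2 * s).+1 * t0 a)%N = \sum_o v t0 o.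
  rewrite (bigD1 None) //=; congr (_ + _).
  rewrite [RHS](reindex_omap Some id) //=; last by case.
  by apply: eq_bigl => a; rewrite eqxx.
have card_le : #|{: option 'I_r}|%:R <= 2 ^+ s :> R.
  by rewrite card_option card_ord -natrX ler_nat.
have cardM (x y z : R) : 0 <= x -> 2 ^+ s * x <= y -> y <= z ->
    #|{: option 'I_r}|%:R * x <= z.
  by move=> x0 xy yz; apply: le_trans yz; apply: le_trans xy; apply: ler_wpM2r.
have cardM' (x y z : R) : 0 <= x -> x <= y -> 2 ^+ s * y <= z ->
    #|{: option 'I_r}|%:R * x <= z.
  move=> x0 xy yz; apply: le_trans yz; apply: ler_pM => //.
have pos (t0 : 'I_r -> nat) : (forall a, t0 a < n)%N -> forall a,
    (s + (2 * s).+1 * t0 a + s < M)%N.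
  move=> h a; have := h a; apply: contraTltn => le; nia.
rewrite !sumv; apply: sign_sum_uniform.
  by case=> [a|] //=; apply: sgn; have := pos _ tn a; have := pos _ tn' a; lia.
pose valid (t0 : 'I_r -> nat) :=
  (forall a b : 'I_r, (a < b)%N -> (t0 a < t0 b)%N) /\ forall a, (t0 a < n)%N.
pose dominates o o' := forall t0, valid t0 ->
  #|{: option 'I_r}|%:R * `|v t0 o'| <= `|v t0 o|.
have lt_dom (a b : 'I_r) : (a < b)%N ->
    dominates (Some a) (Some b) \/ dominates (Some b) (Some a).
  move=> ab; case: (cmp a b ab) => h; [left|right] => t0 [t0i t0n] /=.
  - have pa := pos _ t0n a; have pb := pos _ t0n b; have := t0i _ _ ab => tab.
    have [[q [q1 q2 hq]] _] := geometric_near (geo a) (leq_addr _ _) pa.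
    apply: cardM' hq => //; apply: h; nia.
  - have pa := pos _ t0n a; have pb := pos _ t0n b; have := t0i _ _ ab => tab.
    have [[q [q1 q2 hq]] _] := geometric_near (geo b) (leq_addr _ _) pb.
    apply: cardM' hq => //; apply: h; nia.
have c_dom a : dominates None (Some a) \/ dominates (Some a) None.
  case: (cmpc a) => h; [right|left] => t0 [t0i t0n] /=.
  - have pa := pos _ t0n a.
    have [[q [q1 q2 hq]] _] := geometric_near (geo a) (leq_addr _ _) pa.
    apply: cardM' hq => //; apply: h; lia.
  - have pa := pos _ t0n a.
    have [_ [q [q1 q2 hq]]] := geometric_near (geo a) (leq_addr _ _) pa.
    apply: cardM hq _ => //; apply: h; lia.
move=> o o' oo'.
suff : dominates o o' \/ dominates o' o.
  by case=> d; [left|right]; split; apply: d; split.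
case: o o' oo' => [a|] [b|] //= oo'.
- have : (a : nat) != b by apply: contraNneq oo' => /val_inj ->.
  by rewrite neq_ltn => /orP[] /lt_dom []; [left|right|right|left].
- by case: (c_dom a); [right|left].
Qed.


(** * Extraction of geometric subsequences *)

Lemma dist_additive (R : realFieldType) (x y z : R) :
  sign_of (y - x) = sign_of (z - y) -> `|z - x| = `|y - x| + `|z - y|.
Proof.
move=> /sign_ofP[]; have -> : z - x = (y - x) + (z - y) by lra.
move: (y - x) (z - y) => a b.
case: (ltrgt0P a) => ha; case: (ltrgt0P b) => hb // _ _.
- by rewrite gtr0_norm //; lra.
- by rewrite ltr0_norm //; lra.
- by rewrite ha hb addr0 normr0.
Qed.

(** The component at [(k, a, b)] describes [i < j < l]: two booleans for the sign of [x(l) - x(j)],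
    then the gap of [a] over [j, l] against that over [i, j], then the gap of [b] over [i, l]
    against that of [a] over [i, j]. *)
Definition triple_colour (m r : nat) :=
  {ffun 'I_m * 'I_r * 'I_r -> bool * bool * bool * bool}.
Definition sign_colour (m r : nat) := {ffun 'I_m * 'I_r -> bool * bool}.
(** Comparisons with a single variable point: a deviation from the base against the constant, two
    deviations against each other, and a gap from the first point against a full gap. *)
Definition unary_colour (m r : nat) :=
  {ffun 'I_m * 'I_r * 'I_r -> bool * bool * bool}.

(* W plays the role of a point at infinity. The base of a decreasing function is
   its value at W. For an increasing one it is the value at the first selected
   point h, which is known only after the relations G have been made homogeneous;
   this is harmless because the comparison of two increasing functions relative
   to h does not depend on the larger index, hence is a unary condition. *)
Lemma geometric_subsequence (R : realFieldType) (m r M W : nat)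
    (y : 'I_m -> 'I_r -> nat -> R) (C := unary_colour m r) :
  (forall k a i j i' j', (i < j)%N -> (j <= W)%N -> (i' < j')%N -> (j' <= W)%N ->
    sign_of (y k a j - y k a i) = sign_of (y k a j' - y k a i')) ->
  (forall k a i j l l', (i < j)%N -> (j < l)%N -> (j < l')%N -> (l <= W)%N ->
    (l' <= W)%N -> (`|y k a l - y k a j| <= `|y k a j - y k a i|)
       = (`|y k a l' - y k a j| <= `|y k a j - y k a i|)) ->
  (forall k a b i j l l', (i < j)%N -> (j < l)%N -> (j < l')%N -> (l <= W)%N ->
    (l' <= W)%N -> (`|y k b l - y k b i| <= `|y k a j - y k a i|)
       = (`|y k b l' - y k b i| <= `|y k a j - y k a i|)) ->
  (0 < M)%N -> ((#|C| * M).+1 ^ (m * r ^ 2).+1 <= W)%N ->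
  exists (g : nat -> nat) (base : 'I_m -> 'I_r -> R)
         (u := fun k a p => y k a (g p) - base k a),
  [/\ increasing_on M g, forall p, (p < M)%N -> (g p < W)%N &
  forall k,
  [/\ forall a, geometric M (fun p => `|u k a p|),
      forall a p q, (p < M)%N -> (q < M)%N ->
        sign_of (u k a p) = sign_of (u k a q),
      forall a b : 'I_r, (a < b)%N ->
     (forall p q, (p < q)%N -> (q < M)%N -> `|u k b q| <= `|u k a p|) \/
     (forall p q, (p < q)%N -> (q < M)%N -> `|u k a p| <= `|u k b q|)
    & forall a,
       (forall p, (p < M)%N -> `|\sum_b base k b| <= `|u k a p|) \/
       (forall p, (p < M)%N -> `|u k a p| <= `|\sum_b base k b|)]].
Proof.
move=> Hs H3 H4 M0 leW.
pose gap k a i j := `|y k a j - y k a i|.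
have gapD k a i j l : (i < j)%N -> (j < l)%N -> (l <= W)%N ->
    gap k a i l = gap k a i j + gap k a j l.
  by move=> ij jl lW; apply: dist_additive; apply: Hs; lia.
have gap0 k a i j : 0 <= gap k a i j by apply: normr_ge0.
have gapW k a i j : (i <= j)%N -> (j < W)%N -> gap k a j W <= gap k a i W.
  rewrite leq_eqVlt => /predU1P[->//|ij jW].
  by rewrite (gapD k a i j W) // lerDr.
have gapS k a i i' j' j : (i <= i')%N -> (i' < j')%N -> (j' <= j)%N ->
    (j < W)%N -> gap k a i' j' <= gap k a i j.
  move=> ii' ij' jj' jW.
  apply: (@le_trans _ _ (gap k a i j')).
    move: ii'; rewrite leq_eqVlt => /predU1P[->//|ii'].
    by rewrite (gapD k a i i' j') //; [rewrite lerDr|lia].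
  move: jj'; rewrite leq_eqVlt => /predU1P[->//|jj'].
  by rewrite (gapD k a i j' j) //; [rewrite lerDl|lia|lia].
(* The diagonal slots test for geometric increase or decrease, the others compare two decreasing
   functions; hence [m * r ^ 2] relations suffice. *)
pose G (x : 'I_m * 'I_r * 'I_r) : rel nat := fun i j =>
  let: (k, a, b) := x in
  if a == b then gap k a i j < gap k a j W else gap k a i W <= gap k b j W.
(* Shrinking the interval can only decrease the left sides of both comparisons and increase the
   right sides. *)
have hG x : hereditary_below W (G x).
  case: x => [[k a] b] i i' j' j ii' ij jj' jW; rewrite /G.
  case: eqP => _ h.
    apply: le_lt_trans (gapS k a _ _ _ _ ii' ij jj' jW) _.
    by apply: lt_le_trans h _; apply: gapW.
  apply: (le_trans (gapW k a i i' ii' _)); first lia.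
  by apply: le_trans h _; apply: gapW.
(* One point more than [#|C| * M]: [g 0] becomes the base point [h], and the indices from 1 on enter
   the later pigeonhole. *)
have [|||g [gi gW gG]] := @homogeneous_hereditary _ G W (#|C| * M).+1
  (enum {: 'I_m * 'I_r * 'I_r}) 0 W.
- by move=> x _; apply: hG.
- by rewrite -cardT !card_prod !card_ord -mulnA mulnn.
- by [].
have {}gG x : exists b : bool, forall p q, (p < q)%N -> (q < (#|C| * M).+1)%N ->
    G x (g p) (g q) = b by apply: gG; rewrite mem_enum.
pose inc k a := G (k, a, a) (g 0%N) (g 1%N).
pose h := g 0%N.
have C0 : (0 < #|C|)%N by apply/card_gt0P; exists [ffun=> (true, true, true)].
have sz1 : (1 < (#|C| * M).+1)%N by rewrite ltnS muln_gt0 C0.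
have Ginc k a p q : (p < q)%N -> (q < (#|C| * M).+1)%N ->
    (gap k a (g p) (g q) < gap k a (g q) W) = inc k a.
  have [b hb] := gG (k, a, a) => pq qM; have := hb _ _ pq qM.
  by rewrite /inc (hb 0 1)%N // /G eqxx.
pose base k a := if inc k a then y k a h else y k a W.
pose e k a p := `|y k a (g p) - base k a|.
have eE k a p : e k a p = if inc k a then gap k a h (g p) else gap k a (g p) W.
  by rewrite /e /base /gap; case: (inc k a) => //; rewrite distrC.
pose c p : C := [ffun x : 'I_m * 'I_r * 'I_r => let: (k, a, b) := x in
  (`|\sum_b base k b| <= e k a p, e k b p <= e k a p,
   gap k b h W <= gap k a h (g p))].
have [|g2 [g2i g2M cg2]] := @pigeonhole_subsequence _ (fun p => c p.+1)
  (#|C| * M)%N M.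
  by [].
have gW' p : (p < (#|C| * M).+1)%N -> (g p < W)%N by move=> /gW.
have ltg p q : (p < q)%N -> (q < (#|C| * M).+1)%N -> (g p < g q)%N by exact: gi.
have inc_lt k a p q : inc k a -> (0 < p)%N -> (p < q)%N ->
    (q < (#|C| * M).+1)%N -> 2 * e k a p <= e k a q.
  move=> ia p0 pq qM; rewrite !eE ia.
  have hp : (h < g p)%N by apply: ltg => //; lia.
  have gpq := ltg _ _ pq qM; have gqW := gW' _ qM.
  have : ~~ (gap k a (g p) W <= gap k a h (g p)).
    by rewrite -ltNge Ginc //; lia.
  (* By [H3] the point [W] may be replaced by [g q], so the gap from [g p] to [g q] exceeds the
     distance from [h] to [g p]. *)
  rewrite [_ <= _](H3 k a h (g p) W (g q)) // ?(ltn_trans gpq) // ?(ltnW gqW) //.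
  rewrite -ltNge (gapD k a h (g p) (g q)) // ?(ltnW gqW) //.
  by rewrite -/(gap k a _ _) -/(gap k a _ _); lra.
have dec_lt k a p q : inc k a = false -> (p < q)%N ->
    (q < (#|C| * M).+1)%N -> 2 * e k a q <= e k a p.
  move=> ia pq qM; rewrite !eE ia.
  have gpq := ltg _ _ pq qM; have gqW := gW' _ qM.
  have := Ginc k a _ _ pq qM; rewrite ia => /negbT; rewrite -leNgt.
  by rewrite (gapD k a (g p) (g q) W) //; lra.
have mono1 k a p q : inc k a -> (0 < p)%N -> (p < q)%N ->
    (q < (#|C| * M).+1)%N -> e k a p <= e k a q.
  move=> ia p0 pq qM; have := inc_lt k a p q ia p0 pq qM.
  have : 0 <= e k a p by apply: normr_ge0.
  lra.
have mono2 k a p q : inc k a = false -> (p < q)%N ->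
    (q < (#|C| * M).+1)%N -> e k a q <= e k a p.
  move=> ia pq qM; have := dec_lt k a p q ia pq qM.
  have : 0 <= e k a q by apply: normr_ge0.
  lra.
have g2M' p : (p < M)%N -> ((g2 p).+1 < (#|C| * M).+1)%N by move=> /g2M.
have g2lt p q : (p < q)%N -> (q < M)%N -> ((g2 p).+1 < (g2 q).+1)%N.
  exact: g2i.
have cE k a b p q : (p < M)%N -> (q < M)%N ->
  [/\ (`|\sum_b base k b| <= e k a (g2 p).+1)
        = (`|\sum_b base k b| <= e k a (g2 q).+1),
      (e k b (g2 p).+1 <= e k a (g2 p).+1)
        = (e k b (g2 q).+1 <= e k a (g2 q).+1)
    & (gap k b h W <= gap k a h (g (g2 p).+1))
        = (gap k b h W <= gap k a h (g (g2 q).+1))].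
  move=> pM qM; have := cg2 _ _ pM qM => /ffunP/(_ (k, a, b)).
  by rewrite !ffunE => -[].
exists (fun p => g (g2 p).+1), base; split.
- by move=> p q pq qM; apply: ltg; [apply: g2lt|apply: g2M'].
- by move=> p /g2M' /gW'.
move=> k; split.
- move=> a; case ia : (inc k a); [right|left] => p q pq qM.
  + by apply: inc_lt => //; [apply: g2lt|apply: g2M'].
  + by apply: dec_lt => //; [apply: g2lt|apply: g2M'].
- move=> a p q pM qM; rewrite /base; case ia : (inc k a).
    by apply: Hs; [apply: ltg => //; exact: g2M'|exact/ltnW/gW'/g2M'
      |apply: ltg => //; exact: g2M'|exact/ltnW/gW'/g2M'].
  (* The base of a decreasing function is its value at [W], so its deviation is the opposite of an
     increment. *)
  have sgnN (z z' : R) : sign_of z = sign_of z' -> sign_of (- z) = sign_of (- z').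
    by move=> /sign_ofP[]; rewrite /sign_of !oppr_eq0 !oppr_gt0; do 2!case: ltrgt0P.
  rewrite -[X in sign_of X = _]opprB -[X in _ = sign_of X]opprB; apply: sgnN.
  by apply: Hs => //; exact/gW'/g2M'.
- move=> a b ab.
  (* Two increasing functions are compared through the full gap of [b] from [h], where [H4]
     exchanges [W] for the larger index. For opposite directions a comparison at a common point
     extends by monotonicity. Two decreasing functions are settled by [G (k, a, b)]. *)
  case ia : (inc k a); case ib : (inc k b).
  + have [hh|hh] := boolP (gap k b h W <= gap k a h (g (g2 0%N).+1)); [left|right].
    * move=> p q pq qM; have pM := ltn_trans pq qM.
      have [_ _ hp] := cE k a b p 0%N pM M0; rewrite -hp in hh.
      rewrite -/(e k b _) -/(e k a _) !eE ia ib; apply: le_trans hh.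
      rewrite [X in _ <= X](gapD k b h (g (g2 q).+1) W) ?lerDl //.
      by apply: ltg => //; exact: g2M'.
      exact/gW'/g2M'.
    * move=> p q pq qM; have pM := ltn_trans pq qM.
      have [_ _ hp] := cE k a b p 0%N pM M0; rewrite -hp in hh.
      rewrite -/(e k b _) -/(e k a _) !eE ia ib; apply: ltW; rewrite ltNge.
      have hgp : (h < g (g2 p).+1)%N by apply: ltg => //; exact: g2M'.
      have gqW : (g (g2 q).+1 < W)%N by exact/gW'/g2M'.
      have gpq : (g (g2 p).+1 < g (g2 q).+1)%N.
        by apply: ltg; [exact: g2lt|exact: g2M'].
      by rewrite [_ <= _](H4 k a b h (g (g2 p).+1) (g (g2 q).+1) W) //;
        [exact: ltn_trans gpq gqW|exact: ltnW].
  + have [hh|hh] := boolP (e k b (g2 0%N).+1 <= e k a (g2 0%N).+1); [left|right];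
      move=> p q pq qM; have pM := ltn_trans pq qM.
    * have [_ hp _] := cE k a b p 0%N pM M0; rewrite -hp in hh.
      by apply: le_trans (mono2 k b _ _ ib _ _) hh; [apply: g2lt|apply: g2M'].
    * have [_ hp _] := cE k a b q 0%N qM M0; rewrite -hp -ltNge in hh.
      by apply: le_trans (mono1 k a _ _ ia _ _ _) (ltW hh); [|apply: g2lt|apply: g2M'].
  + have [hh|hh] := boolP (e k b (g2 0%N).+1 <= e k a (g2 0%N).+1); [left|right];
      move=> p q pq qM; have pM := ltn_trans pq qM.
    * have [_ hp _] := cE k a b q 0%N qM M0; rewrite -hp in hh.
      by apply: le_trans hh (mono2 k a _ _ ia _ _); [apply: g2lt|apply: g2M'].
    * have [_ hp _] := cE k a b p 0%N pM M0; rewrite -hp -ltNge in hh.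
      by apply: le_trans (ltW hh) (mono1 k b _ _ ib _ _ _); [|apply: g2lt|apply: g2M'].
  + have ab' : a != b by rewrite neq_ltn ab.
    have [[] hb] := gG (k, a, b); [right|left] => p q pq qM;
      have := hb _ _ (g2lt _ _ pq qM) (g2M' _ qM);
      rewrite /G (negbTE ab') -/(e k b _) -/(e k a _) !eE ia ib //.
    by move=> /negbT; rewrite -ltNge => /ltW.
- move=> a; have [hh|hh] := boolP (`|\sum_b base k b| <= e k a (g2 0%N).+1);
    [left|right] => p pM; have [hp _ _] := cE k a a p 0%N pM M0.
  + by rewrite -/(e k a _) hp.
  + by rewrite -/(e k a _); apply: ltW; rewrite ltNge hp.
Qed.


(** * Composition of the selections and the resulting bound *)

(** The three bounds reverse the order of selection, each being the number of points its step needs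
    to feed the next. The factor [(2 * r).+1] pays for thinning, and the [.+1] of
    [prehomogeneous_bound] for the last point. *)
Definition geometric_bound (m r n : nat) : nat :=
  (#|{: unary_colour m r}| * ((2 * r).+1 * n)).+1 ^ (m * r ^ 2).+1.
Definition prehomogeneous_bound (m r n : nat) : nat :=
  (#|{: sign_colour m r}| * geometric_bound m r n).+1.
Definition vertex_bound (m r n : nat) : nat :=
  (2 * #|{: triple_colour m r}| ^ prehomogeneous_bound m r n)
    ^ prehomogeneous_bound m r n.

Lemma uniform_sign_sums (R : realFieldType) (m r n N : nat)
    (x : 'I_m -> 'I_r -> nat -> R) :
  (0 < n)%N -> (vertex_bound m r n <= N)%N ->
  exists g : nat -> nat, [/\ increasing_on n g,
    forall p, (p < n)%N -> (g p < N)%N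
    & forall k (t t' : 'I_r -> nat),
        (forall a b : 'I_r, (a < b)%N -> (t a < t b)%N) ->
        (forall a b : 'I_r, (a < b)%N -> (t' a < t' b)%N) ->
        (forall a, t a < n)%N -> (forall a, t' a < n)%N ->
        sign_of (\sum_a x k a (g (t a))) = sign_of (\sum_a x k a (g (t' a)))].
Proof.
move=> n0 leN.
set T := prehomogeneous_bound m r n in leN.
pose W := geometric_bound m r n.
pose c i j l : triple_colour m r :=
  [ffun z : 'I_m * 'I_r * 'I_r => let: (k, a, b) := z in
    (x k a l - x k a j == 0, 0 < x k a l - x k a j,
     `|x k a l - x k a j| <= `|x k a j - x k a i|,
     `|x k b l - x k b i| <= `|x k a j - x k a i|)].
have [g0 [g0i g0N cg0]] := @erdos_rado _ c T N leN.
pose w := (#|{: sign_colour m r}| * W)%N.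
have TE : T = w.+1 by [].
(* By now the sign of an increment depends only on its left end and can be computed against the last
   point [g0 w]. Making it constant makes every function monotone. *)
pose c1 p : sign_colour m r := [ffun z : 'I_m * 'I_r => let: (k, a) := z in
  (x k a (g0 w) - x k a (g0 p) == 0, 0 < x k a (g0 w) - x k a (g0 p))].
have [//|g1 [g1i g1w cg1]] := @pigeonhole_subsequence _ c1 w W.
(* Position [W] holds the last point, which is the point at infinity for [geometric_subsequence]. *)
pose g p := if (p < W)%N then g0 (g1 p) else g0 w.
pose f p := if (p < W)%N then g1 p else w.
have gE p : g p = g0 (f p) by rewrite /g /f; case: ifP.
have fi p q : (p < q)%N -> (q <= W)%N -> (f p < f q)%N.
  move=> pq qW; rewrite /f (leq_trans pq qW) /=.
  by case: (ltnP q W) => qW'; [apply: g1i|apply: g1w; apply: leq_trans pq qW].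
have fT p : (f p < T)%N by rewrite TE ltnS /f; case: (ltnP p W) => // /g1w/ltnW.
have gi p q : (p < q)%N -> (q <= W)%N -> (g p < g q)%N.
  by move=> pq qW; rewrite !gE; apply: g0i => //; apply: fi.
have cg i j l l' k a b : (i <= j)%N -> (j < l)%N -> (j < l')%N ->
    (l <= W)%N -> (l' <= W)%N ->
    c (g i) (g j) (g l) (k, a, b) = c (g i) (g j) (g l') (k, a, b).
  move=> ij jl jl' lW lW'; rewrite !gE; congr (fun_of_fin _ _).
  apply: cg0 => //; try exact: fi.
  move: ij; rewrite leq_eqVlt => /predU1P[->//|ij].
  by apply/ltnW/fi => //; apply: ltnW; apply: leq_trans lW.
have [||||//|g2 [base [g2i g2W g2P]]] :=
  @geometric_subsequence R m r ((2 * r).+1 * n) W (fun k a p => x k a (g p)).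
(* With its first two indices equal, the triple colour gives the sign of an increment over a
   pair. *)
- have sgnW k a i j : (i < j)%N -> (j <= W)%N ->
      sign_of (x k a (g j) - x k a (g i)) = sign_of (x k a (g W) - x k a (g i)).
    move=> ij jW; have := cg i i j W k a a (leqnn _) ij (leq_trans ij jW) jW (leqnn _).
    by rewrite !ffunE => -[h1 h2 _ _]; apply/sign_ofP.
  move=> k a i j i' j' ij jW ij' jW'; rewrite sgnW // [RHS]sgnW //.
  have iW := leq_trans ij jW; have iW' := leq_trans ij' jW'.
  have /ffunP/(_ (k, a)) := cg1 _ _ iW iW'.
  rewrite !ffunE => -[h1 h2]; apply/sign_ofP.
  by rewrite /g ltnn iW iW'.
- move=> k a i j l l' ij jl jl' lW lW'.
  by have := cg i j l l' k a a (ltnW ij) jl jl' lW lW'; rewrite !ffunE => -[].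
- move=> k a b i j l l' ij jl jl' lW lW'.
  by have := cg i j l l' k a b (ltnW ij) jl jl' lW lW'; rewrite !ffunE => -[].
- by rewrite muln_gt0.
(* The window radius is [r], which is enough because [r < 2 ^ r]. *)
pose sp p := (r + (2 * r).+1 * p)%N.
have spM p : (p < n)%N -> (sp p < (2 * r).+1 * n)%N.
  by move=> pn; rewrite /sp; nia.
exists (fun p => g (g2 (sp p))); split.
- move=> p q pq qn; apply: gi; last by apply/ltnW/g2W/spM.
  apply: g2i; last exact: spM.
  by rewrite /sp ltn_add2l ltn_pmul2l.
- by move=> p pn; rewrite gE; apply: g0N.
move=> k t t' ti ti' tn tn'; have [h1 h2 h3 h4] := g2P k.
have sumE (t0 : 'I_r -> nat) : \sum_a x k a (g (g2 (sp (t0 a)))) =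
    \sum_b base k b + \sum_a (x k a (g (g2 (sp (t0 a)))) - base k a).
  by rewrite -big_split /=; apply: eq_bigr => a _; rewrite addrC subrK.
rewrite !sumE.
exact: (sparse_sign h1 h2 h3 h4 (ltn_expl r (ltnSn 1)) (leqnn _)).
Qed.

(** With [T <= B * n ^ E], the bound [(2 * K ^ T) ^ T] is at most [2 ^ (2 * K * T ^ 2)], and
    [2 * E <= 4 * r ^ 2 * m ^ 2]. The constants [B] and [K] depend on [m] and [r] only. *)
Lemma vertex_bound_exponential (m r : nat) : (0 < r)%N -> (0 < m)%N ->
  exists A : nat, (0 < A)%N /\ forall n, (0 < n)%N ->
    (vertex_bound m r n <= 2 ^ (A * n ^ (4 * r ^ 2 * m ^ 2)))%N.
Proof.
move=> r0 m0; set E := (m * r ^ 2).+1.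
pose U := #|{: unary_colour m r}|; pose S := #|{: sign_colour m r}|.
pose K := #|{: triple_colour m r}|.
pose B := (S * (U * (2 * r).+1).+1 ^ E).+1.
have K0 : (0 < K)%N.
  by apply/card_gt0P; exists [ffun=> (true, true, true, true)].
exists (2 * K * B ^ 2)%N; split; first by rewrite !muln_gt0 K0.
move=> n n0; rewrite /vertex_bound -/K.
set T := prehomogeneous_bound m r n.
have leT : (T <= B * n ^ E)%N.
  rewrite /T /prehomogeneous_bound /geometric_bound -/E -/S -/U.
  apply: (@leq_trans (S * ((U * (2 * r).+1).+1 * n) ^ E).+1).
    rewrite ltnS leq_mul2l leq_exp2r // [leqRHS]mulSn mulnA -[leqLHS]add1n.
    by rewrite leq_add2r n0 orbT.
  by rewrite expnMn [leqRHS]mulSn mulnA -[leqLHS]add1n leq_add2r expn_gt0 n0.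
have leE : (E * 2 <= 4 * r ^ 2 * m ^ 2)%N.
  have : (0 < m * r ^ 2)%N by rewrite muln_gt0 m0 expn_gt0 r0.
  rewrite /E -[(m ^ 2)%N]mulnn; move: (r ^ 2)%N => z; nia.
apply: (@leq_trans ((2 ^ (2 * K)) ^ (T * T))).
  rewrite expnM leq_exp2r //; apply: (@leq_trans ((2 * K) ^ T)).
    by rewrite expnMn leq_mul2r expn_eq0; have := ltn_expl T (ltnSn 1);
       rewrite (leq_pexp2l (ltn0Sn 1) (ltn0Sn _) : (2 ^ 1 <= _)%N) ?orbT.
  by rewrite leq_exp2r // ltnW // ltn_expl.
move: (4 * r ^ 2 * m ^ 2)%N leE => F leE.
rewrite -expnM leq_exp2l // -[leqRHS]mulnA leq_mul2l; apply/orP; right.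
apply: (@leq_trans ((B * n ^ E) ^ 2)).
  by rewrite -mulnn leq_mul.
by rewrite expnMn -expnM leq_mul2l leq_pexp2l ?orbT.
Qed.

(** * From semi-algebraic hypergraphs to sums of functions of indices *)

(** A monomial of degree at most 1 involves at most one coordinate of one point, so it can be
    assigned to a single summand. *)
Lemma affine_separable (R : comNzRingType) (r d : nat) (f : mpoly (r * d) R) :
  (0 < r)%N -> (msize f <= 2)%N ->
  exists L : 'I_r -> 'rV[R]_d -> R,
    forall q : 'I_r -> 'rV[R]_d, eval_points f q = \sum_a L a (q a).
Proof.
move=> r0 szf.
have mon (z : multinom (r * d)) : (mdeg z <= 1)%N ->
    exists L : 'I_r -> 'rV[R]_d -> R, forall q : 'I_r -> 'rV[R]_d,
    \prod_i (mxvec (\matrix_(a < r) q a) 0 i) ^+ z i = \sum_a L a (q a).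
  rewrite leq_eqVlt ltnS leqn0 mdeg_eq0 => /orP[/mdeg1P[i /eqP->]|/eqP->].
    case/mxvec_indexP: i => a b; exists (fun a' v => if a' == a then v 0 b else 0).
    move=> q; rewrite -big_mkcond big_pred1_eq /=.
    rewrite (bigD1 (mxvec_index a b)) //= mnm1E eqxx expr1 big1 ?mulr1.
      by rewrite mxvecE mxE.
    by move=> i /negbTE ne; rewrite mnm1E eq_sym ne.
  (* The constant monomial is charged to the first point, which exists because [0 < r]. *)
  exists (fun a _ => if a == Ordinal r0 then 1 else 0) => q.
  rewrite -big_mkcond big_pred1_eq big1 // => i _.
  by rewrite mnm0E.
suff [L hL] : exists L : 'I_r -> 'rV[R]_d -> R, forall q : 'I_r -> 'rV[R]_d,
    \sum_(z <- msupp f) mcoeff z f *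
      \prod_i (mxvec (\matrix_(a < r) q a) 0 i) ^+ z i = \sum_a L a (q a).
  by exists L => q; rewrite /eval_points mevalE.
have : all (fun z => mdeg z <= 1)%N (msupp f).
  by apply/allP => z /msize_mdeg_lt lt; rewrite -ltnS; apply: leq_trans szf.
elim: (msupp f) => [_|z s IH /= /andP[/mon[L hL] /IH[L' hL']]].
  by exists (fun _ _ => 0) => q; rewrite big_nil big1.
exists (fun a v => mcoeff z f * L a v + L' a v) => q.
by rewrite big_cons hL hL' big_split mulr_sumr.
Qed.

Lemma enum_val_increasing (N : nat) (A : {set 'I_N}) (i j : 'I_#|A|) :
  (i < j)%N -> (enum_val i < enum_val j)%N.
Proof.
move=> ij; have i0 : 'I_N := enum_val i.
have srt : sorted (relpre val ltn) (enum A).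
  apply: (subseq_sorted _ (_ : subseq (enum A) (enum 'I_N))).
  - by move=> x y z; apply: ltn_trans.
  - by rewrite (enumT 'I_N); exact: filter_subseq.
  by rewrite -sorted_map val_enum_ord iota_ltn_sorted.
rewrite !(enum_val_nth i0).
apply: (sorted_ltn_nth (leT := relpre val ltn) _ i0 srt) => //.
- by move=> x y z; apply: ltn_trans.
- by rewrite inE -cardE.
- by rewrite inE -cardE.
Qed.

Lemma ramsey_vertex_bound (R : realType) (r d m n N : nat) :
  (0 < r)%N -> (0 < n)%N -> (vertex_bound m r n <= N)%N ->
  ramsey_property R r d 1 m n N.
Proof.
move=> r0 n0 leN V E cV _ [v [p [f [Phi [bv szf hE]]]]].
have [L hL] := fin_all_exists (fun k => affine_separable r0 (szf k)).
have VN : (0 < #|V|)%N.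
  by rewrite cV; apply: leq_trans leN; rewrite expn_gt0 muln_gt0 expn_gt0;
     rewrite (_ : (0 < #|_|)%N) //; apply/card_gt0P;
     exists [ffun=> (true, true, true, true)].
(* The default vertex is taken only at indices out of range, which [g] avoids. *)
pose x k a i := L k a (p (insubd (Ordinal VN) i)).
have [] := @uniform_sign_sums R m r n #|V| x n0; first by rewrite cV.
move=> g [gi gN gs].
pose h (i : 'I_n) : 'I_#|V| := Ordinal (gN i (ltn_ord i)).
have hh (i : 'I_n) : insubd (Ordinal VN) (g i) = h i.
  by apply: val_inj; rewrite val_insubd gN.
have h_inj : injective h.
  move=> i j /(congr1 val) /= gij; apply: val_inj => /=.
  by case: (ltngtP i j) => // ij; have := gi _ _ ij (ltn_ord _); rewrite gij ltnn.
pose S := [set v (h i) | i : 'I_n].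
(* Edges are described by increasing tuples only, so each [r]-subset of [S] is listed in the order
   of the enumeration [v]. *)
have edge (e : {set V}) : e \subset S -> #|e| = r -> exists t : 'I_r -> 'I_n,
    (forall a b : 'I_r, (a < b)%N -> (t a < t b)%N) /\
    e = [set v (h (t a)) | a : 'I_r].
  move=> eS er; pose A := [set i | v i \in e].
  have eA : e = v @: A.
    apply/setP => z; have [v' vK v'K] := bv; apply/idP/imsetP => [ze|[i]].
      by exists (v' z); rewrite ?inE v'K.
    by rewrite inE => ie ->.
  have Ar : #|A| = r by rewrite -er eA card_imset //; apply: bij_inj.
  pose i (a : 'I_r) := enum_val (cast_ord (esym Ar) a).
  have iP a : exists j : 'I_n, i a = h j.
    have : i a \in A by apply: enum_valP.
    rewrite inE => /(subsetP eS) /imsetP[j _ /(bij_inj bv) ->].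
    by exists j.
  have [t tP] := fin_all_exists iP; exists t; split.
    move=> a b ab; have : (i a < i b)%N by apply: enum_val_increasing.
    rewrite !tP /= ltnNge; apply: contraR; rewrite -leqNgt leq_eqVlt.
    move=> /predU1P[->//|ba]; exact/ltnW/gi.
  apply/setP => z; rewrite eA; apply/imsetP/imsetP => [[j jA ->]|[a _ ->]].
    exists (cast_ord Ar (enum_rank_in jA j)) => //.
    by rewrite -tP /i cast_ordK enum_rankK_in.
  by exists (i a); [apply: enum_valP|rewrite tP].
have same (e e' : {set V}) : e \subset S -> #|e| = r -> e' \subset S ->
    #|e'| = r -> (e \in E) = (e' \in E).
  move=> eS er eS' er'.
  have [t [ti ->]] := edge e eS er; have [t' [ti' ->]] := edge e' eS' er'.
  rewrite (hE (fun a => h (t a))); last by move=> a b /ti ab; apply: gi.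
  rewrite (hE (fun a => h (t' a))); last by move=> a b /ti' ab; apply: gi.
  congr Phi; apply/ffunP => k; rewrite !ffunE !hL.
  have sumE (t0 : 'I_r -> 'I_n) :
      \sum_a x k a (g (t0 a)) = \sum_a L k a (p (h (t0 a))).
    by apply: eq_bigr => a _; rewrite /x hh.
  by rewrite -!sumE; apply: (gs k t t').
exists S; split.
  by rewrite card_imset ?card_ord // => i j /(bij_inj bv) /h_inj.
(* All [r]-subsets of [S] have the same status, so a single non-edge makes [S] independent. *)
have [[e [eS er eE]]|no] := pselect (exists e : {set V},
  [/\ e \subset S, #|e| = r & e \notin E]); [right|left] => e' eS' er'.
  by rewrite (same e' e).
by apply/negPn/negP => eE'; apply: no; exists e'.
Qed.

Theorem theorem3 (R : realType) (r m : nat) (hr : (0 < r)%N) (hm : (0 < m)%N) :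
  exists c : R, 0 < c /\
    forall d n : nat, (0 < d)%N -> (0 < n)%N ->
      exists N : nat, is_ramsey_number R r d 1 m n N /\
        N%:R <= 2 `^ (c * n%:R ^+ (4 * r ^ 2 * m ^ 2)).
Proof.
have [A [A0 leA]] := vertex_bound_exponential hr hm.
exists A%:R; split; first by rewrite ltr0n.
move=> d n _ n0.
(* The classical boolean form of the property lets [ex_minn] produce the Ramsey number itself. *)
pose P N := `[< ramsey_property R r d 1 m n N >].
have exP : exists N, P N.
  by exists (vertex_bound m r n); apply/asboolP; apply: ramsey_vertex_bound.
exists (ex_minn exP); case: ex_minnP => N /asboolP PN minN; split.
  by split=> // N' PN'; apply: minN; apply/asboolP.
have leN : (N <= 2 ^ (A * n ^ (4 * r ^ 2 * m ^ 2)))%N.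
  apply: leq_trans (leA n n0); apply: minN; apply/asboolP.
  exact: ramsey_vertex_bound.
rewrite -natrX -natrM powR_mulrn // -natrX ler_nat.
exact: leN.
Qed.
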